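(* Let $G$ be a finite undirected graph (possibly with loops and multiple edges) with nonempty vertex set $V$ and edge set $E$, and let $b\in\mathbb{R}^V$ have all entries nonnegative. Let $H=\mathrm{gr}(u)$ be the graph of a vertex $u$ of the polytope $\mathcal{P}(G,b)$. Then $u$ is the only element of $\mathcal{P}(G,b)$ whose graph is $H$, and it is given explicitly, for each $e\in E$, by \[u_e=\begin{cases} k_e\sum_{v\in V_{H\setminus e}(t_e)}(-1)^{d_{H\setminus e}(v,t_e)}\,b_v, & e\text{ is an edge of }H,\\ 0,&\text{otherwise,}\end{cases}\] where $k_e=\frac12$ if $e$ is an edge of a nonloop cycle of $H$ and $k_e=1$ otherwise; $t_e$ is the endpoint of $e$ furthest from $L$ if $e$ is an edge of a component of $H$ that contains a single cycle $L$ but $e$ is not in $L$, and $t_e$ is an arbitrarily chosen endpoint of $e$ otherwise; $H\setminus e$ is the graph obtained by deleting the edge $e$ from $H$; $V_{H\setminus e}(t_e)$ is the vertex set of the component of $H\setminus e$ which contains $t_e$; and $d_{H\setminus e}(v,t_e)$ is the length of the (necessarily unique) path between $v$ and $t_e$ in $H\setminus e$.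
   Context: $\delta_G(v)$ denotes the set of edges of $G$ incident with $v$; a loop at $v$ appears once in $\delta_G(v)$. $\mathcal{P}(G,b)=\{x\in\mathbb{R}^E \mid x_e\ge 0 \text{ for each } e\in E,\ \sum_{e\in\delta_G(v)}x_e=b_v \text{ for each } v\in V\}$ (when $E=\emptyset$, $\mathbb{R}^\emptyset=\{0\}$, so it is $\{0\}$ if $b=0$ and $\emptyset$ otherwise). For $x\in\mathcal{P}(G,b)$, the graph $\mathrm{gr}(x)$ of $x$ is the spanning subgraph of $G$ (vertex set $V$) with edge set $\{e\in E\mid x_e>0\}$. A cycle of length 1 is a vertex together with a loop attached to it (a nonloop cycle is one of length at least 2), and a cycle of length 2 is two distinct vertices together with two distinct edges connecting them. *)

(* Defs.v *)
From mathcomp Require Import all_boot all_order all_algebra.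
From mathcomp Require Import boolp classical_sets reals.

Set Implicit Arguments.
Unset Strict Implicit.
Unset Printing Implicit Defensive.

Import Order.TTheory GRing.Theory Num.Theory.
Local Open Scope ring_scope.

(* Finite undirected graphs with loops and multiple edges; an edge with a
   single end is a loop. *)
Record multigraph := Multigraph {
  vert : finType;
  edge : finType;
  ends : edge -> {set vert};
  card_ends : forall e, (0 < #|ends e| <= 2)%N
}.
Arguments ends {m} e.

Section Graphs.

Variable G : multigraph.
Local Notation V := (vert G).
Local Notation E := (edge G).

Definition incident (v : V) : {set E} := [set e | v \in ends e].

(* Below, a spanning subgraph of G is represented by its edge set F. *)
Implicit Types (F C : {set E}) (v w : V) (p : seq (E * V)).

Definition adjacent F : rel V :=
  [rel v w | [exists e in F, ends e == [set v; w]]].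

Definition component F v : {set V} := [set w | connect (adjacent F) v w].

(* A walk is given by its initial vertex and by its list of steps, a step
   being the edge that is traversed and the vertex that is reached.  The
   length of the walk is the length of the list. *)
Fixpoint walk F v p : bool :=
  if p is (e, w) :: p' then
    [&& e \in F, ends e == [set v; w] & walk F w p']
  else true.

Definition is_path F v w p : bool :=
  [&& walk F v p, last v (unzip2 p) == w & uniq (v :: unzip2 p)].

(* Cycles are represented by their edge sets, so that the length of a cycle C
   is #|C| and the choice of base point and orientation is immaterial.  The
   distinctness of edges only matters for length 2, where it excludes
   traversing the same edge back and forth. *)
Definition is_cycle F C : Prop :=
  exists v p,
    [/\ p != [::], walk F v p, last v (unzip2 p) = v,
        uniq (unzip1 p) && uniq (unzip2 p) & C = [set e in unzip1 p]].

Definition support C : {set V} := \bigcup_(e in C) ends e.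

(* The length of the path from v to w; only meaningful when there is exactly
   one such path. *)
Definition path_length F v w : nat :=
  size (xget [::] [set p | is_path F v w p]%classic).

(* The distance in F from v to a set of vertices S.  As paths have length less
   than #|V|, it is #|V| when no vertex of S can be reached. *)
Definition distance_to F (S : {set V}) v : nat :=
  find (fun n => `[< exists w p, [/\ w \in S, is_path F v w p & size p = n] >])
       (iota 0 #|V|).

Definition only_cycle_in F (K : {set V}) C : Prop :=
  [/\ is_cycle F C, support C \subset K &
      forall C', is_cycle F C' -> support C' \subset K -> C' = C].

(* t may be chosen as the end t_e of the edge e of F. *)
Definition admissible_end F (e : E) (t : V) : Prop :=
  t \in ends e /\
  forall L, only_cycle_in F (component F t) L -> e \notin L ->
    forall s, s \in ends e ->
      (distance_to F (support L) s <= distance_to F (support L) t)%N.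

Definition edge_coef (R : realType) F (e : E) : R :=
  if `[< exists C, [/\ is_cycle F C, (1 < #|C|)%N & e \in C] >] then 2^-1 else 1.

Section Polytope.

Variables (R : realType) (b : {ffun V -> R}).

Definition polytope (x : {ffun E -> R}) : Prop :=
  (forall e, 0 <= x e) /\ (forall v, \sum_(e in incident v) x e = b v).

Definition polytope_vertex (u : {ffun E -> R}) : Prop :=
  polytope u /\
  forall (x y : {ffun E -> R}) (a : R),
    polytope x -> polytope y -> 0 < a < 1 ->
    (forall e, u e = a * x e + (1 - a) * y e) -> x = u /\ y = u.

Definition gr (x : {ffun E -> R}) : {set E} := [set e | 0 < x e].

End Polytope.

End Graphs.

Arguments edge_coef {G} R F e.

(* Main.v *)
(* The columns of the incidence matrix indexed by the edges of H = gr u are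
   linearly independent, since u could otherwise be moved both ways within the
   polytope; this gives uniqueness.  Alternating the signs along a walk from v
   to w gives a vector whose boundary depends only on v, w and the parity of the
   length, so independence makes any two such walks use every edge equally often
   modulo 2 ([parity_rigid]).  Hence every cycle of H is odd, each component of
   H has at most one, and the component T of t_e in H \ e contains none.  The
   signs (-1)^d(v,t_e) on T thus cancel at the ends of each edge of T, so that in
   sum_(v in T) (-1)^d(v,t_e) b_v only e contributes: once, or twice if e is on a
   nonloop cycle, since both its ends are then in T at even distance. *)

Require Import Defs.
From mathcomp Require Import all_boot all_order all_algebra.
From mathcomp Require Import boolp reals zify ring.

Set Implicit Arguments.
Unset Strict Implicit.
Unset Printing Implicit Defensive.

Import Order.TTheory GRing.Theory Num.Theory.
Local Open Scope ring_scope.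

(** Supplies the two steps at which a walk with a repeated vertex or edge is cut. *)
Lemma not_uniq_map_split (A : Type) (B : eqType) (g : A -> B) (r : seq A) :
  ~~ uniq (map g r) ->
  exists a1 a2 r1 r2 r3, g a1 = g a2 /\ r = r1 ++ a1 :: r2 ++ a2 :: r3.
Proof.
elim: r => //= a r IH; rewrite negb_and negbK => /orP[|/IH]; last first.
  by case=> a1 [a2 [r1 [r2 [r3 [ga ->]]]]]; exists a1, a2, (a :: r1), r2, r3.
move=> gar; have [r2 [a2 [r3 [ga ->]]]] :
    exists r2 a2 r3, g a = g a2 /\ r = r2 ++ a2 :: r3.
  elim: r gar {IH} => //= c r IH; rewrite inE => /predU1P[ga|/IH].
    by exists [::], c, r.
  by case=> r2 [a2 [r3 [ga ->]]]; exists (c :: r2), a2, r3.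
by exists a, a2, [::], r2, r3.
Qed.

Lemma set2_eq (A : finType) (a1 a2 c1 c2 : A) :
  [set a1; a2] = [set c1; c2] -> a1 = c2 /\ a2 = c1 \/ a1 = c1 /\ a2 = c2.
Proof.
move=> /setP eq2; have := eq2 a1; have := eq2 a2; have := eq2 c1.
have := eq2 c2; rewrite !inE !eqxx !orbT /=.
rewrite (eq_sym c2 a1) (eq_sym c2 a2) (eq_sym c1 a1) (eq_sym c1 a2).
case: (a1 =P c1) => [?|_]; case: (a1 =P c2) => [?|_];
  by case: (a2 =P c1) => [?|_]; case: (a2 =P c2) => [?|_] //=; subst; auto.
Qed.

(** * Walks, paths and cycles in a multigraph *)

Section Walks.

Variable G : multigraph.
Local Notation V := (vert G).
Local Notation E := (edge G).
Implicit Types (F H C : {set E}) (e f : E) (v w x t s : V) (p q : seq (E * V)).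

Local Notation target v p := (last v (unzip2 p)).

Lemma walk_cat F v p q :
  walk F v (p ++ q) = walk F v p && walk F (target v p) q.
Proof. by elim: p v => //= -[e w] p IH v /=; rewrite IH !andbA. Qed.

Lemma target_cat v p q : target v (p ++ q) = target (target v p) q.
Proof. by rewrite /unzip2 map_cat last_cat. Qed.

Lemma walk_sub F H v p : F \subset H -> walk F v p -> walk H v p.
Proof.
move=> /subsetP sFH; elim: p v => //= -[e w] p IH v /and3P[/sFH -> -> /IH].
by [].
Qed.

Lemma walk_edges F v p : walk F v p -> {subset unzip1 p <= F}.
Proof.
elim: p v => //= -[e w] p IH v /and3P[eF _ /IH pF] f.
by rewrite inE => /predU1P[->|/pF].
Qed.

Lemma walk_setD1 F v p e :
  walk F v p -> e \notin unzip1 p -> walk (F :\ e) v p.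
Proof.
elim: p v => //= -[f w] p IH v /and3P[fF -> wp].
by rewrite !inE negb_or eq_sym => /andP[-> ep] /=; rewrite fF IH.
Qed.

Lemma walk_notin F v p e : walk (F :\ e) v p -> e \notin unzip1 p.
Proof. by move=> wp; apply/negP => /(walk_edges wp); rewrite !inE eqxx. Qed.

Lemma walk_ends F v p e :
  walk F v p -> e \in unzip1 p -> {subset ends e <= v :: unzip2 p}.
Proof.
elim: p v => //= -[f w] p IH v /and3P[_ /eqP ef wp].
rewrite inE => /predU1P[->|ep] x.
  by rewrite ef !inE => /orP[->|->]; rewrite ?orbT.
by move=> /(IH _ wp ep) /= xp; rewrite inE xp orbT.
Qed.

Lemma ends_other e x : x \in ends e -> exists y, ends e = [set x; y].
Proof.
move=> xe; have := card_ends e; rewrite (cardsD1 x) xe /= ltnS.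
case: (set_0Vmem (ends e :\ x)) => [e0 _|[y yx]].
  exists x; rewrite -(setD1K xe) e0; apply/setP => z.
  by rewrite !inE orbF orbb.
rewrite (cardsD1 y) yx ltnS leqn0 cards_eq0 => /eqP e0.
exists y; rewrite -(setD1K xe) -(setD1K yx) e0.
by rewrite setU0.
Qed.

Lemma connect_adjacentC F : connect_sym (adjacent F).
Proof.
by apply: sym_connect_sym => v w /=; apply: eq_existsb => e; rewrite setUC.
Qed.

Lemma walk_connect F v p : walk F v p -> connect (adjacent F) v (target v p).
Proof.
elim: p v => [|[e w] p IH] v /=; first by rewrite connect0.
move=> /and3P[eF ee /IH]; apply: connect_trans; apply: connect1.
by apply/existsP; exists e; rewrite eF.
Qed.

Lemma walk_connect_mem F v p x :
  walk F v p -> x \in v :: unzip2 p -> connect (adjacent F) v x.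
Proof.
move=> wp; rewrite inE => /predU1P[->|/mapP[[e y] yp ->]]; first exact: connect0.
case/splitPr: p / yp wp => p1 p2; rewrite -cat_rcons walk_cat.
by case/andP => /walk_connect; rewrite /unzip2 map_rcons last_rcons.
Qed.

Lemma walk_support F v p e :
  walk F v p -> e \in unzip1 p -> ends e \subset component F v.
Proof.
move=> wp ep; apply/subsetP => x /(walk_ends wp ep) xp.
by rewrite inE (walk_connect_mem wp).
Qed.

Lemma connect_is_path F v w :
  connect (adjacent F) v w -> exists p, is_path F v w p.
Proof.
move=> /connectP[r pr ->]; case/shortenP: pr => r' pr' ur' _ {r}.
suff [p wp pr] : exists2 p, walk F v p & unzip2 p = r'.
  by exists p; rewrite /is_path wp pr eqxx.
elim: r' v pr' {ur'} => [|x r IH] v /=; first by exists [::].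
move=> /andP[/existsP[e /andP[eF ee]] /IH[p wp pr]].
by exists ((e, x) :: p); rewrite /= ?eF ?ee ?wp ?pr.
Qed.

Lemma is_path_uniq_edges F v w p : is_path F v w p -> uniq (unzip1 p).
Proof.
case/and3P => wp _; elim: p v wp => //= -[e x] p IH v /and3P[_ /eqP ee wp].
case/andP => vp up; rewrite (IH x) // andbT.
apply: contra vp => ep; apply: (walk_ends wp ep).
by rewrite ee !inE eqxx.
Qed.

Lemma is_path_size F v w p : is_path F v w p -> (size p < #|V|)%N.
Proof.
case/and3P => _ _ /card_uniqP; rewrite /= size_map => <-; exact: max_card.
Qed.

Lemma distance_to_finite F (S : {set V}) v :
  (distance_to F S v < #|V|)%N ->
  exists w p, [/\ w \in S, is_path F v w p & size p = distance_to F S v].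
Proof.
rewrite /distance_to; set a := (X in find X _) => lt.
have hasa : has a (iota 0 #|V|) by rewrite has_find size_iota.
by have := nth_find 0%N hasa; rewrite nth_iota // add0n => /asboolP.
Qed.

Lemma distance_to_le F (S : {set V}) v w p :
  w \in S -> is_path F v w p -> (distance_to F S v <= size p)%N.
Proof.
move=> wS wp; have szp := is_path_size wp.
rewrite /distance_to leqNgt; apply/negP => /(before_find 0%N).
by rewrite nth_iota // add0n => /asboolP; apply; exists w, p.
Qed.

(** A shortest path from [s] to [S] avoids [e]: crossing [e] would lead to [t], and the rest would
    be a path from [t] shorter than the distance of [s], which is at most that of [t]. *)
Lemma nearer_end_connect H e s t (S : {set V}) :
  ends e = [set t; s] -> (distance_to H S s <= distance_to H S t)%N ->
  (exists2 w, w \in S & connect (adjacent H) t w) ->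
  exists2 w, w \in S & connect (adjacent (H :\ e)) s w.
Proof.
move=> ee dst [w wS /connect_is_path[p hp]].
(* As [t] reaches [S], the distance of [s] stays below the default value [#|V|] and is attained by a
   path. *)
have [|w' [q [w'S hq szq]]] := @distance_to_finite H S s.
  apply: leq_ltn_trans dst _; apply: leq_ltn_trans (is_path_size hp).
  exact: distance_to_le hp.
have /and3P[wq /eqP lq uq] := hq.
exists w' => //; rewrite -lq; apply: walk_connect; apply: walk_setD1 => //.
apply/negP => /mapP[[f x] + /= ef]; rewrite -{f}ef => exq.
case/splitPr: q / exq hq szq wq lq uq => q1 q2 hq szq wq lq uq.
have xt : x = t.
  have := wq; rewrite walk_cat /= => /and4P[_ _ /eqP ex _].
  have : x \in ends e by rewrite ex !inE eqxx orbT.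
  rewrite ee !inE => /orP[/eqP //|/eqP xs].
  by move: uq; rewrite /unzip2 map_cat /= xs mem_cat inE eqxx orbT.
suff hq2 : is_path H t w' q2.
  have := leq_trans dst (distance_to_le w'S hq2).
  by rewrite -szq size_cat /= addnS ltnNge leq_addl.
rewrite -xt; apply/and3P; split.
- by move: wq; rewrite walk_cat /= => /and4P[].
- by rewrite -lq target_cat /=.
- move: uq; rewrite /unzip2 map_cat /= => /andP[_].
  by rewrite cat_uniq => /and3P[].
Qed.

(** Strong induction on the length: a repeated vertex or edge yields two shorter closed walks, one
    of them odd, and a walk without repetition is a cycle. Oddness matters, since walking an edge
    back and forth need not enclose a cycle. *)
Lemma odd_closed_walk_cycle F v p :
  walk F v p -> target v p = v -> odd (size p) ->
  exists2 C, is_cycle F C & Defs.support C \subset component F v.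
Proof.
have [n] := ubnP (size p); elim: n => // n IH in v p *.
rewrite ltnS => szp wp lp op.
have shorter x q : connect (adjacent F) v x -> (size q < size p)%N ->
    walk F x q -> target x q = x -> odd (size q) ->
    exists2 C, is_cycle F C & Defs.support C \subset component F v.
  move=> vx szq wq lq oq; have [C cC sC] := IH x q (leq_trans szq szp) wq lq oq.
  exists C => //; apply: subset_trans sC _; apply/subsetP => y.
  by rewrite !inE; apply: connect_trans.
have [u2|/not_uniq_map_split] := boolP (uniq (unzip2 p)); last first.
  (* The detour from [x] back to [x] has length [(size p2).+1]; removing it leaves a closed walk at
     [v], and the two lengths add up to that of [p]. *)
  case=> -[e x] [[f y] [p1 [p2 [p3 [/= yx pE]]]]]; subst y.
  move: wp lp op shorter; rewrite pE !(walk_cat, target_cat, size_cat) /=.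
  rewrite !(walk_cat, target_cat, size_cat) /= => /and4P[w1 eF ee].
  move=> /and4P[w2 fF fe w3] lp op shorter.
  have vx : connect (adjacent F) v x.
    have := @walk_connect F v (p1 ++ [:: (e, x)]).
    by rewrite walk_cat target_cat /= w1 eF ee => ->.
  have [o2|e2] := boolP (odd (size p2).+1).
    apply: (shorter x (p2 ++ [:: (f, x)]) vx); rewrite ?size_cat ?addn1 //=.
    - lia.
    - by rewrite walk_cat /= w2 fF fe.
    - by rewrite target_cat.
  apply: (shorter v (p1 ++ (e, x) :: p3)); rewrite ?connect0 ?size_cat //=.
  - lia.
  - by rewrite walk_cat /= w1 eF ee.
  - by rewrite target_cat.
  - lia.
have [u1|/not_uniq_map_split] := boolP (uniq (unzip1 p)); last first.
  case=> -[e x] [[f y] [p1 [p2 [p3 [/= fE pE]]]]]; subst f.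
  move: wp lp op shorter; rewrite pE !(walk_cat, target_cat, size_cat) /=.
  rewrite !(walk_cat, target_cat, size_cat) /=.
  set a := target v p1; set c := target x p2 => /and4P[w1 eF ea].
  move=> /and4P[w2 _ ec w3] lp op shorter.
  have va : connect (adjacent F) v a by apply: walk_connect.
  have vx : connect (adjacent F) v x.
    have := @walk_connect F v (p1 ++ [:: (e, x)]).
    by rewrite walk_cat target_cat /= w1 eF ea => ->.
  have same : c = x /\ y = a \/ c = a /\ y = x.
    exact: set2_eq (etrans (esym (eqP ec)) (eqP ea)).
  (* In the first case [e] is crossed in opposite directions, and dropping both crossings leaves the
     closed walks [p2] and [p1 ++ p3]. In the second it is crossed twice in the same direction, and
     the walk is cut at the common starting end [a]. *)
  case: same => -[cE yE].
    have [o2|e2] := boolP (odd (size p2)).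
      by apply: (shorter x p2 vx) => //; lia.
    apply: (shorter v (p1 ++ p3)); rewrite ?connect0 ?size_cat //=.
    - lia.
    - by rewrite walk_cat w1 -/a -yE.
    - by rewrite target_cat -/a -yE.
    - lia.
  have [o2|e2] := boolP (odd (size p2).+1).
    apply: (shorter a ((e, x) :: p2) va) => //=; first lia.
    by rewrite eF ea w2.
  apply: (shorter v (p1 ++ (e, y) :: p3)); rewrite ?connect0 ?size_cat //=.
  - lia.
  - by rewrite walk_cat w1 /= eF -/a -cE ec.
  - by rewrite target_cat.
  - lia.
exists [set e in unzip1 p].
  by exists v, p; split; rewrite ?u1 //; case: (p) op.
apply/bigcupsP => e; rewrite inE; exact: walk_support.
Qed.

(** * Parity rigidity and its effect on paths and cycles *)

Definition parity_rigid H : Prop := forall v p q,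
  walk H v p -> walk H v q -> target v p = target v q ->
  odd (size p) = odd (size q) ->
  forall e, odd (count_mem e (unzip1 p)) = odd (count_mem e (unzip1 q)).

Lemma count_cat1 p q e : count_mem e (unzip1 (p ++ q)) =
  (count_mem e (unzip1 p) + count_mem e (unzip1 q))%N.
Proof. by rewrite /unzip1 map_cat count_cat. Qed.

(** Paths repeat no edge, so equal parities mean equal edge sets. The first edge of [p] then lies on
    [q] and must come first there, since otherwise [q] would return to [v]. *)
Lemma is_path_parity_inj F v w p q : is_path F v w p -> is_path F v w q ->
  (forall e, odd (count_mem e (unzip1 p)) = odd (count_mem e (unzip1 q))) ->
  p = q.
Proof.
elim: p v q => [|[e x] p IH] v [|[f y] q] hp hq cpq //.
- case/and3P: hq => _ /= /eqP lq /andP[].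
  by have /and3P[_ /eqP /= -> _] := hp; rewrite -lq mem_last.
- case/and3P: hp => _ /= /eqP lp /andP[].
  by have /and3P[_ /eqP /= -> _] := hq; rewrite -lp mem_last.
have /and3P[/= /and3P[eF /eqP ee wp] lp /andP[vp up]] := hp.
have /and3P[/= /and3P[fF /eqP ff wq] lq /andP[vq uq]] := hq.
have ef : e = f.
  have up1 := is_path_uniq_edges hp; have uq1 := is_path_uniq_edges hq.
  have := cpq e; rewrite !count_uniq_mem // !oddb /= !inE eqxx => /esym.
  case: eqP => //= _ eq.
  case/negP: vq; apply: (walk_ends wq eq); by rewrite ee !inE eqxx.
subst f; have xy : x = y.
  by case: (set2_eq (etrans (esym ee) ff)) => -[] // vy xv; rewrite xv vy.
subst y; congr (_ :: _); apply: (IH x).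
- by apply/and3P.
- by apply/and3P.
- by move=> f; have := cpq f; rewrite /= !oddD => /addbI.
Qed.

(** Compared with the empty walk, an even closed walk would have to use its first edge an even
    number of times. *)
Lemma rigid_cycle_odd H v p : parity_rigid H -> p != [::] ->
  walk H v p -> target v p = v -> uniq (unzip1 p) -> odd (size p).
Proof.
case: p => // -[e x] p rH _; set q := _ :: _ => wq lq uq; apply: contraT => even_q.
have := rH v q [::] wq isT lq (negbTE even_q) e.
by rewrite count_uniq_mem // inE eqxx.
Qed.

(** With [r] a path joining the base points, [p ++ r] and [r ++ p'] share their ends and, both
    cycles being odd, their parity. Rigidity then applies, and cancelling [r] modulo 2 leaves the
    same edges in both cycles. *)
Lemma rigid_cycle_uniq H C C' v : parity_rigid H ->
  is_cycle H C -> is_cycle H C' ->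
  Defs.support C \subset component H v -> Defs.support C' \subset component H v ->
  C = C'.
Proof.
move=> rH [w [p [p0 wp lp /andP[up _] ->]]] [w' [p' [p'0 wp' lp' /andP[up' _] ->]]].
have base x q : q != [::] -> walk H x q ->
    Defs.support [set e in unzip1 q] \subset component H v ->
    connect (adjacent H) v x.
  case: q => // -[e y] q _ /= /and3P[_ /eqP ee _] /subsetP sup.
  suff /sup : x \in Defs.support [set f in unzip1 ((e, y) :: q)] by rewrite inE.
  by apply/bigcupP; exists e; rewrite ?ee !inE eqxx.
move=> /(base w p p0 wp) vw /(base w' p' p'0 wp') vw'.
have /connect_is_path[r /and3P[wr /eqP lr _]] : connect (adjacent H) w w'.
  by apply: connect_trans vw'; rewrite connect_adjacentC.
apply/setP => e; rewrite !inE.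
have := rH w (p ++ r) (r ++ p'); rewrite !walk_cat !target_cat lp lr lp'.
rewrite wp wr wp' !size_cat !oddD addbC.
rewrite (rigid_cycle_odd rH p0 wp) // (rigid_cycle_odd rH p'0 wp') //.
move=> /(_ isT isT erefl erefl e); rewrite !count_cat1 !oddD addbC => /addbI.
by rewrite !count_uniq_mem // !oddb.
Qed.

Lemma component_sub F H v : F \subset H -> component F v \subset component H v.
Proof.
move=> /subsetP sFH; apply/subsetP => w; rewrite !inE.
apply: connect_sub => x y /existsP[e /andP[/sFH eH exy]].
by apply: connect1; apply/existsP; exists e; rewrite eH.
Qed.

(* An odd cycle avoiding e in the component of t would be the only cycle L of
   the component of H; admissibility then makes the other end of e reach L, and
   hence t, without e.  So e lies on a closed walk that uses it once; adding
   the odd walk p if needed, its parity agrees with that of a walk avoiding e,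
   which rigidity forbids. *)
Lemma admissible_end_even H e t v p :
  parity_rigid H -> e \in H -> admissible_end H e t ->
  v \in component (H :\ e) t -> walk (H :\ e) v p -> target v p = v ->
  ~~ odd (size p).
Proof.
move=> rH eH [te adm] tv wp lp; apply/negP => op.
have sub := subD1set H e.
have [C cC sC] := odd_closed_walk_cycle wp lp op.
have sCt : Defs.support C \subset component (H :\ e) t.
  apply: subset_trans sC _; apply/subsetP => x; rewrite !inE in tv *.
  exact: connect_trans.
have sCH := subset_trans sCt (component_sub t sub).
have [w [pC [pC0 wC lC uC CE]]] := cC.
have cCH : is_cycle H C by exists w, pC; split=> //; apply: walk_sub wC.
have eC : e \notin C by rewrite CE inE (walk_notin wC).
have [s es] := ends_other te.
have wS : w \in Defs.support C.
  case: (pC) pC0 wC CE => // -[f y] q _ /= /and3P[_ /eqP fE _] CE.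
  by apply/bigcupP; exists f; rewrite ?CE ?fE !inE eqxx.
have tw : connect (adjacent (H :\ e)) t w.
  by have := subsetP sCt w wS; rewrite inE.
have [||w' w'S sw'] := @nearer_end_connect H e s t (Defs.support C) es.
- apply: (adm C _ eC s); last by rewrite es !inE eqxx orbT.
  by split=> // C' cC' sC'; apply: rigid_cycle_uniq cCH sC' sCH.
- by exists w => //; have := subsetP sCH w wS; rewrite inE.
have /connect_is_path[q /and3P[wq /eqP lq _]] : connect (adjacent (H :\ e)) s t.
  apply: connect_trans sw' _; rewrite connect_adjacentC.
  by have := subsetP sCt w' w'S; rewrite inE.
have /connect_is_path[r /and3P[wr /eqP lr _]] : connect (adjacent (H :\ e)) t v.
  by rewrite inE in tv.
have eq := walk_notin wq; have er := walk_notin wr; have ep := walk_notin wp.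
have wr' := walk_sub sub wr.
have wl : walk H t (((e, s) :: q) ++ r).
  by rewrite walk_cat /= eH es eqxx lq (walk_sub sub wq).
have ll : target t (((e, s) :: q) ++ r) = v by rewrite target_cat /= lq.
have wp' : walk H t (r ++ p) by rewrite walk_cat wr' lr (walk_sub sub wp).
have ct : odd (count_mem e (unzip1 (((e, s) :: q) ++ r))).
  by rewrite count_cat1 /= eqxx !(count_memPn _).
have [par|par] := eqVneq (odd (size (((e, s) :: q) ++ r))) (odd (size r)).
  have := rH t _ r wl wr' (etrans ll (esym lr)) par e.
  by rewrite ct (count_memPn er).
have lp' : target t (r ++ p) = v by rewrite target_cat lr.
have := rH t _ (r ++ p) wl wp' (etrans ll (esym lp')).
have -> : odd (size (r ++ p)) = ~~ odd (size r).
  by rewrite size_cat oddD op addbT.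
have -> : odd (size (((e, s) :: q) ++ r)) = ~~ odd (size r).
  by move: par; case: (odd _); case: (odd _).
by move=> /(_ erefl e); rewrite ct count_cat1 !(count_memPn _).
Qed.

(** * Signs on the component of [t] in [H :\ e] *)

Section TreeSide.

Variables (H : {set E}) (e : E) (t : V).
Hypotheses (rH : parity_rigid H) (eH : e \in H) (adm : admissible_end H e t).
Local Notation F := (H :\ e).
Local Notation T := (component F t).

(** The same path [r] from [t] back to [v] closes up both walks, and closed walks in [T] are
    even. *)
Lemma walk_parity v p q : v \in T -> walk F v p -> walk F v q ->
  target v p = t -> target v q = t -> odd (size p) = odd (size q).
Proof.
move=> vT wp wq lp lq; have := vT; rewrite inE.
case/connect_is_path => r /and3P[wr /eqP lr _].
have even p' : walk F v p' -> target v p' = t -> odd (size p') = odd (size r).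
  move=> wp' lp'; have := admissible_end_even rH eH adm vT (p := p' ++ r).
  rewrite walk_cat target_cat lp' wp' wr => /(_ isT lr).
  by rewrite size_cat oddD; case: (odd _); case: (odd _).
by rewrite (even p) // (even q).
Qed.

(** Two such paths agree in parity, so rigidity gives them the same edges. This makes the choice in
    [path_length] harmless. *)
Lemma tree_path v : v \in T -> exists! p, is_path F v t p.
Proof.
move=> vT; have := vT; rewrite inE connect_adjacentC.
case/connect_is_path => p hp; exists p; split => // q hq.
have /and3P[wp /eqP lp _] := hp; have /and3P[wq /eqP lq _] := hq.
have sub := subD1set H e.
apply: (is_path_parity_inj hp hq).
apply: (rH (walk_sub sub wp) (walk_sub sub wq) (etrans lp (esym lq))).
exact: walk_parity vT wp wq lp lq.
Qed.

Lemma path_length_path v : v \in T ->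
  exists2 p, is_path F v t p & size p = path_length F v t.
Proof.
case/tree_path => p [hp _]; exists (classical_sets.xget [::]
  (fun q => is_path F v t q : Prop)) => //.
exact: (@classical_sets.xgetPex _ _ (fun q => is_path F v t q : Prop) (ex_intro _ p hp)).
Qed.

(** Lets the sign of a vertex be read off any walk to [t], not only off the path. *)
Lemma path_length_parity v p : v \in T -> walk F v p -> target v p = t ->
  odd (path_length F v t) = odd (size p).
Proof.
move=> vT wp lp; have [q /and3P[wq /eqP lq _] <-] := path_length_path vT.
exact: walk_parity vT wq wp lq lp.
Qed.

Lemma path_length_step f x y : f \in F -> ends f = [set x; y] -> y \in T ->
  x \in T /\ odd (path_length F x t) = ~~ odd (path_length F y t).
Proof.
move=> fF fE yT; have xT : x \in T.
  move: yT; rewrite !inE => /connect_trans; apply; apply: connect1.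
  by apply/existsP; exists f; rewrite fF fE setUC eqxx.
split=> //; have [p /and3P[wp /eqP lp _] <-] := path_length_path yT.
rewrite (@path_length_parity x ((f, y) :: p)) //=.
by rewrite fF fE eqxx.
Qed.

Variable R : realType.

Lemma sum_sign_ends x y : x != y -> x \in T -> y \in T ->
  forall f, ends f = [set x; y] ->
  \sum_(v in T | f \in incident v) (-1) ^+ path_length F v t =
  (-1) ^+ path_length F x t + (-1) ^+ path_length F y t :> R.
Proof.
move=> xy xT yT f fE; rewrite (eq_bigl (mem [set x; y])).
  by rewrite big_setU1 ?inE //= big_set1.
by move=> v; rewrite /= [f \in _]inE fE andb_idl // => /set2P[]->.
Qed.

(** An edge meeting [T] has both ends in [T], with opposite signs; any other edge gives an empty
    sum. *)
Lemma sum_sign_tree_edge f : f \in F ->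
  \sum_(v in T | f \in incident v) (-1) ^+ path_length F v t = 0 :> R.
Proof.
move=> fF.
have [y /andP[yT]|no_end] := pickP [pred v in T | f \in incident v]; last first.
  exact: big_pred0.
rewrite inE => /ends_other[x]; rewrite setUC => fE.
have [xT oxy] := path_length_step fF fE yT.
(* A loop would make the parity at its end differ from itself. *)
have xy : x != y.
  by apply/eqP => xy; move: oxy; rewrite xy; case: (odd _).
rewrite (sum_sign_ends xy xT yT fE) -signr_odd oxy signrN signr_odd addNr.
by [].
Qed.

Lemma path_length_root : path_length F t t = 0%N.
Proof.
have tT : t \in T by rewrite inE connect0.
have [[|[f x] p] /and3P[_ /eqP /= lp]] := path_length_path tT; first by [].
by case/andP; rewrite -{1}lp mem_last.
Qed.

(** Going round the cycle from just after [e] to just before it connects the ends of [e] without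
    using [e]. *)
Lemma is_cycle_bridge C s : is_cycle H C -> e \in C -> ends e = [set t; s] ->
  s \in T.
Proof.
case=> v [p [_ wp lp /andP[up _] ->]]; rewrite inE => ep eE.
case/mapP: ep => -[f x] fp /= ef; subst f.
case/splitPr: p / fp wp lp up => p1 p2.
rewrite walk_cat target_cat /= => /and4P[w1 _ /eqP eE' w2] lp.
rewrite /unzip1 map_cat cat_uniq /= negb_or.
move=> /and3P[_ /andP[ep1 _] /andP[ep2 _]].
have := walk_connect (walk_setD1 w1 ep1).
have := walk_connect (walk_setD1 w2 ep2); rewrite lp => /connect_trans/[apply].
rewrite inE.
by case: (set2_eq (etrans (esym eE) eE')) => -[-> ->] //; rewrite connect_adjacentC.
Qed.

(** The sum is the net number of times [e] is counted in the formula, namely 2 on a nonloop cycle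
    and 1 otherwise; the coefficient is its inverse. *)
Lemma edge_coef_sum :
  edge_coef R H e *
  \sum_(v in T | e \in incident v) (-1) ^+ path_length F v t = 1.
Proof.
have tT : t \in T by rewrite inE connect0.
have [te _] := adm; have [s eE] := ends_other te.
(* Covers loops and bridges at once: in both cases [t] is the only end of [e] in [T]. *)
have sum1 : (s \in T -> s = t) ->
    \sum_(v in T | e \in incident v) (-1) ^+ path_length F v t = 1 :> R.
  move=> sTt; rewrite (big_pred1 t) ?path_length_root // => v.
  rewrite /= [e \in _]inE eE; apply/andP/eqP => [[vT]|->].
    by rewrite !inE => /orP[]/eqP E //; rewrite E in vT *; exact: sTt.
  by rewrite tT !inE eqxx.
rewrite /edge_coef; have [st|st] := eqVneq s t.
  rewrite sum1 // asboolF ?mulr1 //= => -[C [cC C1 eC]].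
  (* The loop [e] is itself a cycle, hence the only one in its component, which excludes a longer
     cycle through [e]. *)
  have c1 : is_cycle H [set e].
    exists t, [:: (e, t)]; split=> //=; first by rewrite eH eE st eqxx.
    by apply/setP => f; rewrite !inE.
  have sT (D : {set E}) : is_cycle H D -> e \in D ->
      Defs.support D \subset component H t.
    move=> [v [p [_ wp _ _ ->]]]; rewrite inE => ep.
    have vt : connect (adjacent H) t v.
      have /subsetP/(_ t te) := walk_support wp ep.
      by rewrite inE connect_adjacentC.
    apply/bigcupsP => f; rewrite inE => /(walk_support wp) /subsetP sf.
    by apply/subsetP => x /sf; rewrite !inE; apply: connect_trans.
  have CE := rigid_cycle_uniq rH cC c1 (sT _ cC eC) (sT _ c1 (set11 e)).
  by rewrite CE cards1 in C1.
have [sT|sT] := boolP (s \in T); last first.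
  rewrite sum1; last by rewrite (negPf sT).
  rewrite asboolF ?mulr1 //= => -[C [cC _ eC]].
  by rewrite (is_cycle_bridge cC eC eE) in sT.
(* The path from [s] to [t] closes up with [e] to an odd cycle of length at least 2. The path is
   thus even, both ends of [e] have sign 1, and the factor 1/2 compensates. *)
have [p hp szp] := path_length_path sT; have /and3P[wp /eqP lp up] := hp.
have eu : uniq (unzip1 ((e, s) :: p)).
  by rewrite /= (walk_notin wp) (is_path_uniq_edges hp).
have wH : walk H t ((e, s) :: p).
  by rewrite /= eH eE eqxx (walk_sub (subD1set H e) wp).
have op : odd (size ((e, s) :: p)) by apply: (rigid_cycle_odd rH _ wH lp eu).
have p0 : (0 < size p)%N by case: (p) lp => //= st'; rewrite st' eqxx in st.
rewrite asboolT /=; last first.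
  exists [set f in unzip1 ((e, s) :: p)]; split.
  - by exists t, ((e, s) :: p); split=> //; rewrite eu.
  - by rewrite cardsE (card_uniqP eu) size_map /= ltnS.
  - by rewrite !inE eqxx.
rewrite setUC in eE; rewrite (sum_sign_ends st sT tT eE) path_length_root -szp.
by rewrite -signr_odd (negPf (_ : ~~ odd (size p))) // mulVf // pnatr_eq0.
Qed.

(** Expanding [b v] over the edges at [v] and exchanging the sums turns the coefficient of each
    [u f] into the sum of the signs at the ends of [f] in [T], which vanishes for [f] in [F]. *)
Lemma edge_formula (b : {ffun V -> R}) (u : {ffun E -> R}) :
  (forall v, \sum_(f in incident v) u f = b v) ->
  (forall f, f \notin H -> u f = 0) ->
  u e = edge_coef R H e * \sum_(v in T) (-1) ^+ path_length F v t * b v.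
Proof.
move=> ub uH.
under eq_bigr => v _ do rewrite -ub mulr_sumr.
rewrite (exchange_big_dep predT) //= (bigD1 e) //= [X in _ + X]big1 ?addr0.
  by rewrite -mulr_suml mulrA edge_coef_sum mul1r.
move=> f fe; rewrite -mulr_suml; have [fH|/uH->] := boolP (f \in H).
  by rewrite sum_sign_tree_edge ?mul0r // !inE fe.
by rewrite mulr0.
Qed.

End TreeSide.

(** * Alternating edge counts: from independence to parity rigidity *)

Section Rigidity.

Variable R : realType.

(** The flag [a] tells whether the current step counts, so [true] and [false] separate the first,
    third, ... steps from the second, fourth, ... ones. *)
Fixpoint parity_count (a : bool) e p : nat :=
  if p is (f, _) :: p' then ((a && (f == e)) + parity_count (~~ a) e p')%N
  else 0%N.

Lemma parity_countD a e p :
  (parity_count a e p + parity_count (~~ a) e p)%N = count_mem e (unzip1 p).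
Proof.
elim: p a => //= -[f x] p IH a /=; rewrite -(IH a) negbK.
by case: a; case: (f == e) => /=; lia.
Qed.

Definition alternating_count e p : R :=
  (parity_count true e p)%:R - (parity_count false e p)%:R.

Lemma alternating_count_cons e f x p :
  alternating_count e ((f, x) :: p) = (f == e)%:R - alternating_count e p.
Proof. by rewrite /alternating_count /= natrD add0n opprB addrA. Qed.

(* A loop meets its end only once, hence the weight 2 it gets here. *)
Lemma alternating_count_boundary F v p x : walk F v p ->
  \sum_(e in incident x) (3 - #|ends e|)%:R * alternating_count e p =
  (x == v)%:R - (-1) ^+ size p * (x == target v p)%:R.
Proof.
elim: p v => [|[f y] p IH] v /=.
  rewrite big1 => [|e _]; last by rewrite /alternating_count subrr mulr0.
  by rewrite mul1r subrr.
case/and3P => _ /eqP fE wp.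
under eq_bigr => e _ do rewrite alternating_count_cons mulrBr.
rewrite sumrB (IH y wp) exprS.
suff -> : \sum_(e in incident x) (3 - #|ends e|)%:R * (f == e)%:R =
    (x == v)%:R + (x == y)%:R :> R by ring.
have [xf|xf] := boolP (f \in incident x).
  rewrite (bigD1 f) //= big1 => [|e /andP[_ /negPf ef]]; last first.
    by rewrite eq_sym ef mulr0.
  move: xf; rewrite !inE eqxx mulr1 addr0 fE cards2 !inE.
  have [<-|vy] := eqVneq v y; first by rewrite orbb -natrD => ->.
  by case/orP => /eqP->; rewrite eqxx ?(negPf vy) 1?eq_sym ?(negPf vy) -natrD.
rewrite big1 => [|e ex]; last first.
  have [fe|] := eqVneq f e; last by rewrite mulr0.
  by rewrite fe ex in xf.
move: xf; rewrite inE fE !inE negb_or => /andP[/negPf-> /negPf->].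
by rewrite addr0.
Qed.

(** The boundary of a weighted alternating count depends only on the ends and the parity of the
    walk, so independence equates the alternating counts of [p] and [q]. These are congruent modulo
    2 to the plain counts. *)
Lemma independent_parity_rigid H :
  (forall z : {ffun E -> R}, (forall e, e \notin H -> z e = 0) ->
    (forall v, \sum_(e in incident v) z e = 0) -> z = 0) ->
  parity_rigid H.
Proof.
move=> indep v p q wp wq lpq par e.
have outside r f : walk H v r -> f \notin H -> alternating_count f r = 0.
  move=> wr fH; have : f \notin unzip1 r.
    by apply: contra fH => /(walk_edges wr).
  move=> /count_memPn; rewrite -(parity_countD true) /alternating_count.
  by move=> /eqP; rewrite addn_eq0 => /andP[/eqP-> /eqP->]; rewrite subrr.
pose z := [ffun f => (3 - #|ends f|)%:R *
  (alternating_count f p - alternating_count f q)].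
have /ffunP/(_ e) : z = 0.
  apply: indep => [f fH|x]; first by rewrite ffunE !outside // subrr mulr0.
  under eq_bigr => f _ do rewrite ffunE mulrBr.
  rewrite sumrB !(@alternating_count_boundary H v) // lpq.
  by rewrite -signr_odd par signr_odd subrr.
(* The weight is 1 or 2, hence nonzero, and can be cancelled. *)
rewrite !ffunE => /eqP; rewrite mulf_eq0 pnatr_eq0 subn_eq0 leqNgt ltnS.
have /andP[_ ->] := card_ends e; rewrite /= subr_eq0 /alternating_count.
(* Moving the negative terms across gives an equality of natural numbers, in which parities can be
   compared. *)
rewrite subr_eq addrAC eq_sym subr_eq -!natrD eqr_nat => /eqP.
rewrite -!(parity_countD true) /=; lia.
Qed.

End Rigidity.

End Walks.

(** * Vertices of the polytope and the explicit formula *)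

Lemma polytope_vertex_independent (R : realType) (G : multigraph)
    (b : {ffun vert G -> R}) (u z : {ffun edge G -> R}) :
  polytope_vertex b u -> (forall e, e \notin gr u -> z e = 0) ->
  (forall v, \sum_(e in incident v) z e = 0) -> z = 0.
Proof.
move=> [[u0 ub] ext] zu zv.
(* [D] dominates every ratio in the sum, so that [z / D] is bounded by [u] in absolute value; the
   leading 1 keeps [D] positive. *)
pose D := 1 + \sum_(e in gr u) `|z e| / u e.
have ue e : e \in gr u -> 0 < u e by rewrite inE.
have term_ge0 e : e \in gr u -> 0 <= `|z e| / u e.
  by move=> /ue /ltW ?; rewrite divr_ge0.
have D0 : 0 < D by rewrite ltr_pwDl // sumr_ge0.
have small e : `|z e / D| <= u e.
  have [eu|/zu->] := boolP (e \in gr u); last by rewrite mul0r normr0.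
  rewrite normrM normfV (gtr0_norm D0) ler_pdivrMr // mulrC -ler_pdivrMr ?ue //.
  rewrite /D (bigD1 e) //= addrCA ler_wpDr // addr_ge0 // sumr_ge0 // => f.
  by case/andP => fu _; apply: term_ge0.
have inP (a : R) : `|a| <= 1 -> polytope b [ffun e => u e + a * (z e / D)].
  move=> a1; split=> [e|v].
    rewrite ffunE -lerBlDl sub0r lerNl; apply: le_trans (small e).
    rewrite (le_trans (ler_norm _)) // normrN normrM.
        by rewrite ler_piMl.
  under eq_bigr => e _ do rewrite ffunE.
  by rewrite big_split /= ub -mulr_sumr -mulr_suml zv mul0r mulr0 addr0.
(* [u] is the midpoint of its two shifts by [z / D], so extremality forces the shift to vanish. *)
have [|||e|/ffunP zu0 _] := ext [ffun e => u e + 1 * (z e / D)]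
    [ffun e => u e + (-1) * (z e / D)] (2^-1).
- by apply: inP; rewrite normr1.
- by apply: inP; rewrite normrN1.
- by rewrite invr_gt0 ltr0n invf_lt1 ?ltr1n.
- by rewrite !ffunE; move: (z e / D) => d; field.
apply/ffunP => e; have := zu0 e; rewrite !ffunE mul1r => /eqP.
by rewrite -subr_eq0 addrC addKr mulf_eq0 invr_eq0 (gt_eqF D0) orbF => /eqP.
Qed.

Theorem theorem24 (R : realType) (G : multigraph) (hV : (0 < #|vert G|)%N)
    (b : {ffun vert G -> R}) (hb : forall v, 0 <= b v)
    (u : {ffun edge G -> R}) (hu : polytope_vertex b u)
    (H : {set edge G}) (hH : H = gr u) :
  (forall x : {ffun edge G -> R}, polytope b x -> gr x = H -> x = u) /\
  (forall t : edge G -> vert G,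
     (forall e, e \in H -> admissible_end H e (t e)) ->
     (forall e v, e \in H -> v \in component (H :\ e) (t e) ->
        exists! p, is_path (H :\ e) v (t e) p) /\
     (forall e, u e =
        if e \in H then
          edge_coef R H e *
          \sum_(v in component (H :\ e) (t e))
             (-1) ^+ path_length (H :\ e) v (t e) * b v
        else 0)).
Proof.
have [[u0 ub] _] := hu.
have u_out e : e \notin H -> u e = 0.
  by rewrite hH inE -leNgt => ue; apply/eqP; rewrite eq_le ue u0.
have indep (z : {ffun edge G -> R}) : (forall e, e \notin H -> z e = 0) ->
    (forall v, \sum_(e in incident v) z e = 0) -> z = 0.
  by rewrite hH; apply: polytope_vertex_independent hu.
split=> [x [x0 xb] xH|t adm].
  (* [x - u] vanishes off [H] and has zero sum at every vertex. *)
  apply/eqP; rewrite -subr_eq0; apply/eqP/indep => [e eH|v].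
    rewrite !ffunE u_out // subr0; apply/eqP; rewrite eq_le x0 andbT.
    by move: eH; rewrite -xH inE -leNgt.
  under eq_bigr => e _ do rewrite !ffunE.
  by rewrite sumrB xb ub subrr.
have rH := independent_parity_rigid indep.
split=> [e v eH vT|e]; first exact: (tree_path rH eH (adm e eH) vT).
have [eH|/u_out //] := boolP (e \in H).
exact: (edge_formula rH eH (adm e eH) ub u_out).
Qed.
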